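(* Consider binary classical communication over a completely positive trace-preserving qubit channel $\mathcal{E}$, with performance measured by either of two functionals: the probability of correct decision $\mathrm{P}_c$ (equivalently, the error probability $\mathrm{P}_e=1-\mathrm{P}_c$, to be minimized) or the classical binary capacity $C_{bin}$. The optimal measurements (among all binary POVMs $\{\Pi_0,\Pi_1\}$) for either functional are always associated to a pair of orthogonal projectors.
   Context: A qubit state is a $2\times2$ complex matrix $\rho=\rho^\dagger\ge 0$ with $\mathrm{tr}(\rho)=1$. A qubit channel is a linear completely positive trace-preserving map $\mathcal{E}$ taking qubit states to qubit states. A binary POVM is a pair $\{\Pi_0,\Pi_1\}$ of positive semidefinite $2\times 2$ matrices with $\Pi_0+\Pi_1=I$. A pair of orthogonal projectors is a binary POVM whose elements are orthogonal projections; the trivial pairs $\{I,0\}$ and $\{0,I\}$ are included. A bit $x\in\{0,1\}$ with distribution $(p_0,p_1)$ is encoded in the state $\rho_x$, sent through $\mathcal{E}$, and measured with $\{\Pi_0,\Pi_1\}$, giving outcome $y\in\{0,1\}$. The associated classical binary channel has transition probabilities $p_{y|x}=\mathrm{tr}(\Pi_y\,\mathcal{E}(\rho_x))$. The probability of correct decision is $\mathrm{P}_c=p_{0|0}\,p_0+p_{1|1}\,p_1$, and the error probability is $\mathrm{P}_e=p_{1|0}\,p_0+p_{0|1}\,p_1=1-\mathrm{P}_c$. The classical binary capacity (for fixed input states and measurements) is $C_{bin}=\max_{(p_0,p_1)}H(x;y)$, where the mutual information is $$H(x;y)=\sum_{x,y\in\{0,1\}} p_{y|x}\,p_x\Big(\log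 p_{y|x}-\log\sum_{x'}p_{y|x'}p_{x'}\Big).$$ *)

(* Defs.v *)
From mathcomp Require Import all_boot all_order all_algebra.
From mathcomp Require Import all_classical all_reals all_analysis.
From mathcomp.real_closed Require Import complex mxtens.

Set Implicit Arguments.
Unset Strict Implicit.
Unset Printing Implicit Defensive.

Import Order.TTheory GRing.Theory Num.Theory.

Local Open Scope classical_set_scope.
Local Open Scope ring_scope.
Local Open Scope complex_scope.
Local Open Scope sesquilinear_scope.

Section Operators.
Variable R : realType.

(* In the order of R[i], 0 <= z says that z is real and nonnegative. *)
Definition psdmx n (A : 'M[R[i]]_n) : Prop :=
  A \is hermsymmx /\ forall v : 'cV[R[i]]_n, 0 <= (v^t* *m A *m v) 0 0.

Definition qubit_state (rho : 'M[R[i]]_2) : Prop :=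
  psdmx rho /\ \tr rho = 1.

(* The (i, j) block, of size n x n, of a matrix acting on C^k (x) C^n. *)
Definition tens_block k n (X : 'M[R[i]]_(k * n)) (i j : 'I_k) : 'M[R[i]]_n :=
  \matrix_(a, b) X (mxtens_index (i, a)) (mxtens_index (j, b)).

(* The map id_k (x) E on k n x k n matrices. *)
Definition ampliation n (E : 'M[R[i]]_n -> 'M[R[i]]_n) k
    (X : 'M[R[i]]_(k * n)) : 'M[R[i]]_(k * n) :=
  \sum_(i < k) \sum_(j < k) delta_mx i j *t E (tens_block X i j).

Definition completely_positive n (E : 'M[R[i]]_n -> 'M[R[i]]_n) : Prop :=
  forall k (X : 'M[R[i]]_(k * n)), psdmx X -> psdmx (ampliation E X).

Definition trace_preserving n (E : 'M[R[i]]_n -> 'M[R[i]]_n) : Prop :=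
  forall A : 'M[R[i]]_n, \tr (E A) = \tr A.

Definition qubit_channel (E : {linear 'M[R[i]]_2 -> 'M[R[i]]_2}) : Prop :=
  completely_positive E /\ trace_preserving E.

(* Bits are booleans: 0 is false and 1 is true. *)
Definition binary_povm (Pi : bool -> 'M[R[i]]_2) : Prop :=
  (forall y, psdmx (Pi y)) /\ Pi false + Pi true = 1%:M.

Definition orthogonal_projection n (P : 'M[R[i]]_n) : Prop :=
  P \is hermsymmx /\ P *m P = P.

Definition orthogonal_projector_pair (Pi : bool -> 'M[R[i]]_2) : Prop :=
  binary_povm Pi /\ forall y, orthogonal_projection (Pi y).

End Operators.

Section Communication.
Variable R : realType.
Variables (E : 'M[R[i]]_2 -> 'M[R[i]]_2) (rho : bool -> 'M[R[i]]_2).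

Definition bit_distribution (p : bool -> R) : Prop :=
  (forall x, 0 <= p x) /\ p false + p true = 1.

(* p_{y|x}; the trace is real for a channel, states and a POVM. *)
Definition transition (Pi : bool -> 'M[R[i]]_2) (y x : bool) : R :=
  complex.Re (\tr (Pi y *m E (rho x))).

Definition prob_correct (p : bool -> R) (Pi : bool -> 'M[R[i]]_2) : R :=
  transition Pi false false * p false + transition Pi true true * p true.

Definition prob_error (p : bool -> R) (Pi : bool -> 'M[R[i]]_2) : R :=
  transition Pi true false * p false + transition Pi false true * p true.

Definition logb (b x : R) : R := ln x / ln b.

(* Since ln 0 = 0, the terms with p_{y|x} = 0 or p_x = 0 vanish, as usual. *)
Definition mutual_information (b : R) (p : bool -> R)
    (Pi : bool -> 'M[R[i]]_2) : R :=
  \sum_(x : bool) \sum_(y : bool)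
    transition Pi y x * p x *
    (logb b (transition Pi y x)
     - logb b (\sum_(x' : bool) transition Pi y x' * p x')).

(* The supremum is a maximum when the transition probabilities form a binary
   channel: mutual information is then continuous on the simplex of p. *)
Definition binary_capacity (b : R) (Pi : bool -> 'M[R[i]]_2) : R :=
  sup [set mutual_information b p Pi | p in [set p | bit_distribution p]].

End Communication.

Definition maximizes_over_povms (R : realType)
    (F : (bool -> 'M[R[i]]_2) -> R) (Pi : bool -> 'M[R[i]]_2) : Prop :=
  binary_povm Pi /\ forall Pi', binary_povm Pi' -> F Pi' <= F Pi.

Definition minimizes_over_povms (R : realType)
    (F : (bool -> 'M[R[i]]_2) -> R) (Pi : bool -> 'M[R[i]]_2) : Prop :=
  binary_povm Pi /\ forall Pi', binary_povm Pi' -> F Pi <= F Pi'.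

(* Main.v *)
(** Write an effect [Pi 0] in its eigenbasis, with eigenvalues [a] and [b]:
    when [a >= b] it is [(a - b) P + b I + (1 - a) 0], where [P] is the rank-one
    projector of [a].  So the binary channel of any POVM is a mixture of the
    channels of the projective pairs [{P, I - P}], [{I, 0}] and [{0, I}].  The
    success probability is affine and, for a fixed input distribution, the
    mutual information is convex along such mixtures, hence a projective pair
    does at least as well.  A best one exists because rank-one projectors are
    parametrized by the compact unit sphere of [C^2]; for the capacity, the
    mutual information is maximized jointly over the sphere and the input
    distribution, which spares the continuity of the capacity itself. *)

Require Import Defs.
From HB Require Import structures.
From mathcomp Require Import all_boot all_order all_algebra.
From mathcomp Require Import all_classical all_reals all_analysis.
From mathcomp.real_closed Require Import complex mxtens.
From mathcomp Require Import ring lra.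

Set Implicit Arguments.
Unset Strict Implicit.
Unset Printing Implicit Defensive.

Import Order.TTheory GRing.Theory Num.Theory.
Import numFieldNormedType.Exports numFieldTopology.Exports.

Local Open Scope classical_set_scope.
Local Open Scope ring_scope.
Local Open Scope complex_scope.
Local Open Scope sesquilinear_scope.

(** * Spectral decomposition of Hermitian two-by-two matrices *)

Section Spectral.
Variable C : numClosedFieldType.

Definition ket_bra n (v : 'cV[C]_n) : 'M[C]_n := v *m v^t*.

Lemma trmxC_mul m n p (A : 'M[C]_(m, n)) (B : 'M[C]_(n, p)) :
  (A *m B)^t* = B^t* *m A^t*.
Proof. by rewrite trmx_mul map_mxM. Qed.

Lemma hermsymmxE n (A : 'M[C]_n) : (A \is hermsymmx) = (A == A^t*).
Proof. by rewrite qualifE /= expr0 scale1r. Qed.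

Lemma diag_form n (A B : 'M[C]_n) i :
  (A^t* *m B *m A) i i = ((col i A)^t* *m B *m col i A) 0 0.
Proof.
rewrite !mxE; apply: eq_bigr => k _; rewrite !mxE; congr (_ * _).
by apply: eq_bigr => l _; rewrite !mxE.
Qed.

(** The conjugate transposes of the rows of the diagonalizing unitary form an orthonormal
    eigenbasis. Completeness comes from the unitary being invertible on both sides. *)
Lemma spectral_decomposition2 (A : 'M[C]_2) : A \is hermsymmx ->
  exists v w : 'cV[C]_2, exists a b : C,
    [/\ v^t* *m v = 1%:M, w^t* *m w = 1%:M, w^t* *m v = 0,
        ket_bra v + ket_bra w = 1%:M & A = a *: ket_bra v + b *: ket_bra w].
Proof.
move=> /hermitian_normalmx/orthomx_spectralP.
set U := spectralmx A; set d := spectral_diag A => defA.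
have uU : U \is unitarymx by exact: spectral_unitarymx.
have UU : U *m U^t* = 1%:M by exact/unitarymxP.
rewrite invmx_unitary// in defA.
have lift1 : lift ord0 ord0 = 1 :> 'I_2 by exact: val_inj.
have row_orth i j : row i U *m (row j U)^t* = (i == j)%:R%:M.
  apply/matrixP => k l; rewrite !ord1 mxE [RHS]mxE eqxx mulr1n.
  have /matrixP/(_ i j) := UU; rewrite !mxE => <-.
  by apply: eq_bigr => m _; rewrite !mxE.
exists ((row 0 U)^t*), ((row 1 U)^t*), (d 0 0), (d 0 1).
rewrite /ket_bra !trmxCK !row_orth !eqxx; split => //.
- by apply/matrixP => i j; rewrite !mxE mul0rn.
- rewrite -(mulmx1C UU); apply/matrixP => i j.
  by rewrite !mxE !big_ord_recl !big_ord0 !mxE !addr0 lift1.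
- rewrite defA mul_mx_diag; apply/matrixP => i j.
  rewrite !mxE !big_ord_recl !big_ord0 !mxE !addr0 lift1.
  by congr (_ + _); rewrite mulrAC mulrC.
Qed.

Lemma eigenvalue_form n (v w : 'cV[C]_n) a b :
  v^t* *m v = 1%:M -> w^t* *m v = 0 ->
  (v^t* *m (a *: ket_bra v + b *: ket_bra w) *m v) 0 0 = a.
Proof.
move=> vv wv; rewrite -mulmxA mulmxDl -!scalemxAl /ket_bra -!mulmxA vv wv.
by rewrite !mulmx0 scaler0 addr0 mulmx1 -scalemxAr vv !mxE eqxx mulr1.
Qed.

(** Both elements of a POVM share an eigenbasis, so the positivity of the second one bounds the
    eigenvalues of the first by 1. *)
Lemma complement_combination n (A B P Q : 'M[C]_n) a b :
  A + B = 1%:M -> P + Q = 1%:M -> A = a *: P + b *: Q ->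
  B = (1 - a) *: P + (1 - b) *: Q.
Proof.
move=> sumAB sumPQ defA; apply: (addrI A); rewrite sumAB defA addrACA.
by rewrite -!scalerDl !(addrC _ (1 - _)) !subrK !scale1r.
Qed.

Lemma mixture_complement n (P Q : 'M[C]_n) a b : P + Q = 1%:M ->
  a *: P + b *: Q = (a - b) *: P + b *: 1%:M.
Proof. by move=> <-; rewrite scalerBl scalerDr addrA addrNK. Qed.

End Spectral.

(** * Positive semidefinite matrices and projections *)

Section PositiveMatrices.
Variable R : realType.

Lemma psdmx_gram m n (B : 'M[R[i]]_(m, n)) : psdmx (B^t* *m B).
Proof.
split; first by rewrite hermsymmxE trmxC_mul trmxCK.
move=> v; rewrite mulmxA -trmxC_mul -mulmxA.
by rewrite mxE sumr_ge0// => i _; rewrite !mxE mulrC mul_conjC_ge0.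
Qed.

Lemma psdmx_projection n (P : 'M[R[i]]_n) : orthogonal_projection P -> psdmx P.
Proof.
move=> [hP PP]; suff -> : P = P^t* *m P by exact: psdmx_gram.
by move: hP; rewrite hermsymmxE => /eqP <-.
Qed.

Lemma complement_projection n (P : 'M[R[i]]_n) :
  orthogonal_projection P -> orthogonal_projection (1%:M - P).
Proof.
move=> [hP PP]; split; last first.
  by rewrite mulmxBl mul1mx mulmxBr mulmx1 PP subrr subr0.
by move: hP; rewrite !hermsymmxE linearB /= map_mxB trmx1 map_mx1 => /eqP <-.
Qed.

(** Idempotence and cyclicity turn the trace into that of [P^t* *m S *m P], whose diagonal entries
    are values of the form of [S] at the columns of [P]. *)
Lemma mxtrace_projection_ge0 n (P S : 'M[R[i]]_n) :
  orthogonal_projection P -> psdmx S -> 0 <= \tr (P *m S).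
Proof.
move=> [+ PP] [_ hS]; rewrite hermsymmxE => /eqP hP.
rewrite -PP -mulmxA mxtrace_mulC {1}hP sumr_ge0// => i _.
by rewrite diag_form.
Qed.

Lemma psdmx_castmx m n (e : m = n) (A : 'M[R[i]]_m) :
  psdmx A -> psdmx (castmx (e, e) A).
Proof. by case: n / e. Qed.

(** This is complete positivity with an ancilla of dimension [k = 1], up to the cast between sizes
    [1 * n] and [n]. *)
Lemma completely_positive_psdmx n (E : 'M[R[i]]_n -> 'M[R[i]]_n) A :
  completely_positive E -> psdmx A -> psdmx (E A).
Proof.
move=> hE hA.
have := hE 1 _ (psdmx_castmx (esym (mul1n n)) hA).
rewrite /ampliation !big_ord1.
set B := tens_block _ _ _.
have -> : B = A.
  apply/matrixP => a b; rewrite !mxE castmxE /=.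
  by congr (A _ _); apply: val_inj => /=; rewrite mul0n add0n.
have -> : delta_mx ord0 ord0 = 1 :> 'M[R[i]]_1.
  by apply/matrixP => a b; rewrite !mxE !ord1.
rewrite tens_scalar1mx => /(psdmx_castmx (mul1n n)).
by rewrite castmxKV.
Qed.

Lemma ket_bra_projection n (v : 'cV[R[i]]_n) :
  v^t* *m v = 1%:M -> orthogonal_projection (ket_bra v).
Proof.
move=> v1; split; first by rewrite hermsymmxE trmxC_mul trmxCK.
by rewrite mulmxA -(mulmxA v) v1 mulmx1.
Qed.

End PositiveMatrices.

(** * Binary POVMs as mixtures of projective pairs *)

Section QubitMeasurements.
Variable R : realType.

Lemma complex_unit_interval (z : R[i]) :
  0 <= z -> 0 <= 1 - z -> exists2 r : R, z = r%:C & 0 <= r <= 1.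
Proof.
move=> z0 z1; exists (complex.Re z); first by rewrite RRe_real// ger0_real.
move: z0 z1; case: z => x y.
by rewrite !lecE /= subr_ge0 => /andP[_ ->] /andP[_ ->].
Qed.

(* [l], [m0] and [m1] are the weights of the pairs [{vv*, I - vv*}], [{I, 0}]
   and [{0, I}]. *)
Lemma povm_mixture (Pi : bool -> 'M[R[i]]_2) : binary_povm Pi ->
  exists v : 'cV[R[i]]_2, exists l m0 m1 : R,
    [/\ v^t* *m v = 1%:M, [/\ 0 <= l, 0 <= m0 & 0 <= m1], l + m0 + m1 = 1
      & Pi false = l%:C *: ket_bra v + m0%:C *: 1%:M].
Proof.
move=> [psdPi sumPi].
have [[hA posA] [_ posB]] := (psdPi false, psdPi true).
have [v [w [a [b [vv ww wv sum1 defA]]]]] := spectral_decomposition2 hA.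
have vw : v^t* *m w = 0.
  by rewrite -[LHS]trmxCK trmxC_mul trmxCK wv trmx0 map_mx0.
have defB := complement_combination sumPi sum1 defA.
(* With the summands swapped, [eigenvalue_form] reads off the eigenvalue at [w]. *)
have defA' := etrans defA (addrC _ _).
have defB' := etrans defB (addrC _ _).
have a0 : 0 <= a by have := posA v; rewrite defA eigenvalue_form.
have b0 : 0 <= b by have := posA w; rewrite defA' eigenvalue_form.
have a1 : 0 <= 1 - a by have := posB v; rewrite defB eigenvalue_form.
have b1 : 0 <= 1 - b by have := posB w; rewrite defB' eigenvalue_form.
have [r ra r01] := complex_unit_interval a0 a1.
have [s sb s01] := complex_unit_interval b0 b1.
(* The projector is taken on the eigenvector of the larger eigenvalue, which makes the weight [l],
   the eigenvalue gap, nonnegative. *)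
case: (leP s r) => [sr|/ltW rs].
- exists v, (r - s), s, (1 - r); split;
    [exact: vv|by split; lra|ring|].
  by rewrite defA ra sb rmorphB; exact: mixture_complement.
- exists w, (s - r), r, (1 - s); split;
    [exact: ww|by split; lra|ring|].
  by rewrite defA' ra sb rmorphB; apply: mixture_complement; rewrite addrC.
Qed.

End QubitMeasurements.

(** * Continuity of pairs and of arithmetic operations *)

Lemma continuous_pair (T U V : topologicalType) (f : T -> U) (g : T -> V) :
  continuous f -> continuous g -> continuous (fun x => (f x, g x)).
Proof. by move=> cf cg x; apply: cvg_pair; [exact: cf|exact: cg]. Qed.

Section RealFunctions.
Variables (R : realType) (T : topologicalType).
Implicit Types f g : T -> R.

Lemma continuous_funD f g :
  continuous f -> continuous g -> continuous (fun x => f x + g x).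
Proof. by move=> cf cg x; apply: cvgD; [exact: cf|exact: cg]. Qed.

Lemma continuous_funB f g :
  continuous f -> continuous g -> continuous (fun x => f x - g x).
Proof. by move=> cf cg x; apply: cvgB; [exact: cf|exact: cg]. Qed.

Lemma continuous_funM f g :
  continuous f -> continuous g -> continuous (fun x => f x * g x).
Proof. by move=> cf cg x; apply: cvgM; [exact: cf|exact: cg]. Qed.

End RealFunctions.

(** * Compactness of the complex unit sphere *)

Section UnitSphere.
Variable R : realType.

(** Real coordinates on C^n transfer compactness and continuity questions to a real space of
    dimension [n + n]. *)
Definition cvec n (c : 'rV[R]_(n + n)) : 'cV[R[i]]_n :=
  \col_j (c 0 (lshift n j) +i* c 0 (rshift n j)).

Definition unit_sphere n : set 'rV[R]_(n + n) :=
  [set c | (cvec c)^t* *m cvec c = 1%:M].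

Lemma cvec_surj n (v : 'cV[R[i]]_n) : exists c, cvec c = v.
Proof.
exists (row_mx (\row_j complex.Re (v j 0)) (\row_j complex.Im (v j 0))).
apply/matrixP => j k; rewrite !mxE ord1.
by rewrite !(unsplitK (inl _)) !(unsplitK (inr _)) !mxE; case: (v j 0).
Qed.

Lemma Re_sum (I : Type) (r : seq I) (F : I -> R[i]) :
  complex.Re (\sum_(i <- r) F i) = \sum_(i <- r) complex.Re (F i).
Proof. by elim/big_rec2: _ => // i x z _ <-; case: z; case: (F i). Qed.

Lemma continuous_ket_bra_trace n (S : 'M[R[i]]_n) :
  continuous (fun c => complex.Re (\tr (ket_bra (cvec c) *m S))).
Proof.
(* In real coordinates the function is a quadratic polynomial. *)
have -> : (fun c => complex.Re (\tr (ket_bra (cvec c) *m S))) =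
    (fun c : 'rV[R]_(n + n) => \sum_i \sum_j
     ((c 0 (lshift n i) * c 0 (lshift n j) +
       c 0 (rshift n i) * c 0 (rshift n j)) * complex.Re (S j i) -
      (c 0 (rshift n i) * c 0 (lshift n j) -
       c 0 (lshift n i) * c 0 (rshift n j)) * complex.Im (S j i))).
  apply/funext => c; rewrite Re_sum; apply: eq_bigr => i _.
  rewrite mxE Re_sum; apply: eq_bigr => j _; rewrite mxE big_ord1 !mxE.
  by case: (S j i) => x y /=; ring.
have cc k : continuous (fun c : 'rV[R]_(n + n) => c 0 k).
  exact: coord_continuous.
apply: continuous_big => [|i _]; first exact: add_continuous.
apply: continuous_big => [|j _]; first exact: add_continuous.
apply: continuous_funB; apply: continuous_funM; try exact: cst_continuous.
- by apply: continuous_funD; apply: continuous_funM; exact: cc.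
- by apply: continuous_funB; apply: continuous_funM; exact: cc.
Qed.

(** The sphere is a closed level set of the squared norm inside the compact cube of side
    [[-1, 1]]. *)
Lemma compact_unit_sphere n : compact (@unit_sphere n).
Proof.
have sqnorm c : ((cvec c)^t* *m cvec c) 0 0 =
    (\sum_(j < n) (c 0 (lshift n j) ^+ 2 + c 0 (rshift n j) ^+ 2))%:C.
  rewrite mxE rmorph_sum; apply: eq_bigr => j _; rewrite !mxE.
  by apply/eqP; rewrite eq_complex /=; apply/andP; split; apply/eqP; ring.
(* The squared norm is the trace of [ket_bra (cvec c)] against the identity, so its continuity is an
   instance of [continuous_ket_bra_trace]. *)
have sphereE : @unit_sphere n =
    [set c | complex.Re (\tr (ket_bra (cvec c) *m 1%:M)) = 1].
  apply/seteqP; split => c; rewrite /unit_sphere/= mulmx1 mxtrace_mulC.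
    by move=> ->; rewrite mxtrace1.
  rewrite /mxtrace big_ord1 sqnorm /= => c1; apply/matrixP => i j.
  by rewrite !ord1 sqnorm c1 mxE.
pose box := [set c : 'rV[R]_(n + n) | forall k, `[-1, 1]%classic (c 0 k)].
have bounded : @unit_sphere n `<=` box.
  move=> c /matrixP/(_ 0 0); rewrite sqnorm mxE eqxx => -[c1] k.
  have le1 j : c 0 (lshift n j) ^+ 2 + c 0 (rshift n j) ^+ 2 <= 1.
    rewrite -c1 (bigD1 j)//= lerDl sumr_ge0// => l _.
    by rewrite addr_ge0// sqr_ge0.
  rewrite /= in_itv /= -ler_norml -(@ler_pXn2r _ 2)// ?nnegrE//.
  rewrite expr1n real_normK ?num_real//.
  case: (splitP k) => j kj.
    have -> : k = lshift n j by exact: val_inj.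
    by apply: le_trans (le1 j); rewrite lerDl sqr_ge0.
  have -> : k = rshift n j by exact: val_inj.
  by apply: le_trans (le1 j); rewrite lerDr sqr_ge0.
apply: (subclosed_compact _ _ bounded).
- pose normsq (c : 'rV[R]_(n + n)) : R :=
    complex.Re (\tr (ket_bra (cvec c) *m 1%:M)).
  rewrite sphereE.
  apply: (preimage_closed (f := normsq) (D := [set x | x = 1])).
    by move=> c _; exact: continuous_ket_bra_trace.
  exact: closed_eq.
- have := @rV_compact R (n + n) (fun=> `[-1, 1]%classic)
    (fun=> @segment_compact R _ _).
  exact.
Qed.

End UnitSphere.

(** * Success probability and mutual information of binary channels *)

Section BinaryChannels.
Variable R : realType.
Implicit Types (p a d u v l m : R).

Definition xlnx u := u * ln u.

(* [ln y <= y] at [y = u] and at [y = 1 / sqrt u]. *)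
Lemma normr_xlnx_le u : `|xlnx u| <= 2 * Num.sqrt u + u ^+ 2.
Proof.
rewrite /xlnx; have [u0|u0] := leP u 0.
  by rewrite ln0// mulr0 normr0 ler0_sqrtr// mulr0 add0r sqr_ge0.
have s0 : 0 < Num.sqrt u by rewrite sqrtr_gt0.
set s := Num.sqrt u in s0 *.
have us : u = s ^+ 2 by rewrite sqr_sqrtr// ltW.
have lnu : ln u = - (2 * ln s^-1).
  by rewrite us lnXn// lnV ?posrE// mulrN opprK mulr_natl.
have lns : ln s^-1 < s^-1 by rewrite ln_sublinear// invr_gt0.
rewrite ler_norml; apply/andP; split.
  have lnu_ge : - (2 * s^-1) <= ln u by rewrite lnu; lra.
  have := ler_wpM2l (ltW u0) lnu_ge.
  have -> : u * - (2 * s^-1) = - (2 * s) by rewrite us; field; rewrite gt_eqF.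
  by apply: le_trans; rewrite lerN2 lerDl sqr_ge0.
have := ler_wpM2l (ltW u0) (ltW (ln_sublinear u0)); rewrite -expr2.
by move=> /le_trans; apply; rewrite lerDr mulr_ge0// ltW.
Qed.

(** Only [u = 0] is delicate: there the bound of [normr_xlnx_le] tends to 0. For negative [u] the
    function is locally zero, since [ln] vanishes on nonpositive reals. *)
Lemma continuous_xlnx : continuous xlnx.
Proof.
move=> u; have [u0|u0|->] := ltgtP u 0.
- apply: (cvg_near_cst (xlnx u)); apply: filterS (lt_nbhsl u0) => w w0.
  by rewrite /xlnx !ln0 ?mulr0// ltW.
- by apply: cvgM; [exact: cvg_id|exact: continuous_ln].
- pose bound (w : R) := 2 * Num.sqrt w + w ^+ 2.
  have cbound : continuous bound.
    apply: continuous_funD; last exact: exprn_continuous.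
    by apply: continuous_funM; [exact: cst_continuous|exact: sqrt_continuous].
  have bound0 : bound 0 = 0 by rewrite /bound sqrtr0 expr0n /= mulr0 addr0.
  rewrite /continuous_at {2}/xlnx mul0r.
  apply: norm_cvg0; apply: (squeeze_cvgr (f := cst 0) (h := bound)).
  + by apply: nearW => w; rewrite normr_ge0 normr_xlnx_le.
  + exact: cvg_cst.
  + by have := cbound 0; rewrite /continuous_at bound0.
Qed.

(** One summand of the Kullback-Leibler divergence, in nats. *)
Definition relative_entropy_term u v := u * (ln u - ln v).

(** Log-sum inequality for the pairs [(l * u, l * v)] and [(m, m)], the second of which contributes
    zero. The implication from [v = 0] to [u = 0] is absolute continuity, excluding the case where
    the divergence would be infinite but [ln 0 = 0] makes it finite. *)
Lemma relative_entropy_mixture u v l m :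
  0 <= u -> 0 <= v -> (v = 0 -> u = 0) -> 0 <= l -> 0 <= m ->
  relative_entropy_term (l * u + m) (l * v + m) <=
    l * relative_entropy_term u v.
Proof.
rewrite /relative_entropy_term => u0 v0 vu l0 m0.
have [->|l_neq0] := eqVneq l 0; first by rewrite !mul0r !add0r subrr mulr0.
have {l_neq0} l_gt0 : 0 < l by rewrite lt0r l_neq0.
have [->|u_neq0] := eqVneq u 0.
  rewrite mul0r !mulr0 add0r.
  have [->|m_neq0] := eqVneq m 0; first by rewrite mul0r.
  have m_gt0 : 0 < m by rewrite lt0r m_neq0.
  have lv_ge0 : 0 <= l * v by rewrite mulr_ge0.
  rewrite mulr_ge0_le0// subr_le0 ler_ln ?posrE//; first by rewrite lerDr.
  exact: ltr_wpDl.
have u_gt0 : 0 < u by rewrite lt0r u_neq0.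
have v_gt0 : 0 < v.
  by rewrite lt0r v0 andbT; apply: contra u_neq0 => /eqP/vu ->.
set U := l * u + m; set V := l * v + m.
have U_gt0 : 0 < U by rewrite ltr_wpDr// mulr_gt0.
have V_gt0 : 0 < V by rewrite ltr_wpDr// mulr_gt0.
have ln_tangent (x : R) : 0 < x -> ln x <= x - 1.
  by move=> x0; rewrite -[in ln x](subrKC 1 x) le_ln1Dx// ltrBrDl subrr.
(* Combine the tangent inequality at [v U / (u V)] and at [U / V], with weights
   [l u] and [m]. *)
have := ln_tangent _ (divr_gt0 (mulr_gt0 v_gt0 U_gt0) (mulr_gt0 u_gt0 V_gt0)).
have := ln_tangent _ (divr_gt0 U_gt0 V_gt0).
rewrite !ln_div ?posrE ?mulr_gt0// !lnM ?posrE// => tangent1 tangent2.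
have := ler_wpM2l m0 tangent1.
have := ler_wpM2l (mulr_ge0 l0 u0) tangent2.
have -> : l * u * (v * U / (u * V) - 1) = l * v * (U / V) - l * u.
  by field; rewrite !gt_eqF.
(* The right-hand sides of the two weighted inequalities add up to [V * (U / V) - U], which is
   zero. *)
have VX : V * (U / V) = U by rewrite mulrC divfK// gt_eqF.
move: VX; rewrite {1}/V {3}/U; set X := U / V; set LU := ln U; set LV := ln V.
rewrite /U; clear; move: (ln u) (ln v) => Lu Lv VX H1 H2; nra.
Qed.

Lemma continuous_coord1 : continuous (fun z : R * (R * R) => z.1).
Proof. by move=> z; exact: cvg_fst. Qed.

Lemma continuous_coord2 : continuous (fun z : R * (R * R) => z.2.1).
Proof.
by move=> z; apply: (@cvg_comp _ _ _ snd fst); [exact: cvg_snd|exact: cvg_fst].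
Qed.

Lemma continuous_coord3 : continuous (fun z : R * (R * R) => z.2.2).
Proof. by move=> z; apply: (@cvg_comp _ _ _ snd snd); exact: cvg_snd. Qed.

Lemma continuous_onem (T : topologicalType) (f : T -> R) :
  continuous f -> continuous (fun z => 1 - f z).
Proof. by move=> cf; apply: continuous_funB => //; exact: cst_continuous. Qed.

(** Here [p] stands for p_0, and the channel is encoded by the probabilities of outcome 0: [a] for
    p_{0|0} and [d] for p_{0|1}. *)
Definition success_probability p a d := a * p + (1 - d) * (1 - p).

Lemma continuous_success_probability :
  continuous (fun z : R * (R * R) => success_probability z.1 z.2.1 z.2.2).
Proof.
apply: continuous_funD; apply: continuous_funM.
- exact: continuous_coord2.
- exact: continuous_coord1.
- by apply: continuous_onem; exact: continuous_coord3.
- by apply: continuous_onem; exact: continuous_coord1.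
Qed.

(** The channels [(1, 1)] and [(0, 0)] are those of the trivial pairs; the function is affine in
    [(a, d)]. *)
Lemma success_probability_mixture p a d l m0 m1 : l + m0 + m1 = 1 ->
  success_probability p (l * a + m0) (l * d + m0) =
  l * success_probability p a d + m0 * success_probability p 1 1 +
    m1 * success_probability p 0 0.
Proof.
move=> sum1; have -> : m1 = 1 - l - m0 by rewrite -sum1; ring.
by rewrite /success_probability; ring.
Qed.

(** Mutual information in nats, as the average divergence of the conditional output laws from the
    output law [(q, 1 - q)]. *)
Definition binary_information p a d :=
  let q := p * a + (1 - p) * d in
  p * relative_entropy_term a q + (1 - p) * relative_entropy_term d q +
  (p * relative_entropy_term (1 - a) (1 - q) +
   (1 - p) * relative_entropy_term (1 - d) (1 - q)).

Lemma continuous_binary_information :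
  continuous (fun z : R * (R * R) => binary_information z.1 z.2.1 z.2.2).
Proof.
pose q (z : R * (R * R)) := z.1 * z.2.1 + (1 - z.1) * z.2.2.
(* Regrouped as output entropy minus conditional entropy, the expression contains logarithms only
   through [xlnx], which is continuous even at 0. *)
have -> : (fun z : R * (R * R) => binary_information z.1 z.2.1 z.2.2) =
    (fun z => (z.1 * xlnx z.2.1 + (1 - z.1) * xlnx z.2.2 - xlnx (q z)) +
      (z.1 * xlnx (1 - z.2.1) + (1 - z.1) * xlnx (1 - z.2.2) - xlnx (1 - q z))).
  apply/funext => -[p [a d]].
  rewrite /binary_information /relative_entropy_term /xlnx /q /=.
  by ring.
have c1 := @continuous_coord1; have ca := @continuous_coord2.
have cd := @continuous_coord3.
have cq : continuous q.
  apply: continuous_funD; apply: continuous_funM;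
    [exact: c1|exact: ca|exact: (continuous_onem c1)|exact: cd].
have cx (f : R * (R * R) -> R) : continuous f -> continuous (xlnx \o f).
  move=> cf z; apply: continuous_comp; first exact: cf.
  exact: continuous_xlnx.
have cx1 (f : R * (R * R) -> R) :
    continuous f -> continuous (fun z => xlnx (1 - f z)).
  by move=> cf; exact: cx (continuous_onem cf).
apply: continuous_funD.
  apply: continuous_funB; last exact: (cx _ cq).
  apply: continuous_funD; apply: continuous_funM;
    [exact: c1|exact: (cx _ ca)|exact: (continuous_onem c1)|exact: (cx _ cd)].
apply: continuous_funB; last exact: (cx1 _ cq).
apply: continuous_funD; apply: continuous_funM;
  [exact: c1|exact: (cx1 _ ca)|exact: (continuous_onem c1)|exact: (cx1 _ cd)].
Qed.

Lemma binary_information_constant p a : binary_information p a a = 0.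
Proof.
have pa : p * a + (1 - p) * a = a by ring.
by rewrite /binary_information /relative_entropy_term pa !subrr !mulr0 !addr0.
Qed.

(** The trivial pairs carry no information, so it remains to apply [relative_entropy_mixture] to
    each of the four terms, with offset [m0] for outcome 0 and [m1] for outcome 1. *)
Lemma binary_information_mixture p a d l m0 m1 :
  0 <= p <= 1 -> 0 <= a <= 1 -> 0 <= d <= 1 ->
  0 <= l -> 0 <= m0 -> 0 <= m1 -> l + m0 + m1 = 1 ->
  binary_information p (l * a + m0) (l * d + m0) <=
  l * binary_information p a d + m0 * binary_information p 1 1 +
    m1 * binary_information p 0 0.
Proof.
move=> p01 a01 d01 l0 m00 m10 sum1.
rewrite !binary_information_constant !mulr0 !addr0 /binary_information.
set q := p * a + (1 - p) * d.
have -> : p * (l * a + m0) + (1 - p) * (l * d + m0) = l * q + m0.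
  by rewrite /q; ring.
have compl x : 1 - (l * x + m0) = l * (1 - x) + m1 by lra.
rewrite !compl; move/andP: p01 => [p0 p1].
(* An input of probability [x = 0] is treated apart, since [v = 0] forces [u = 0] through
   [x * u <= v] only when [x] is positive. *)
have weighted x u v m : 0 <= x -> 0 <= u -> x * u <= v -> 0 <= m ->
    x * relative_entropy_term (l * u + m) (l * v + m) <=
      l * (x * relative_entropy_term u v).
  move=> x0 u0 xuv m_ge0; rewrite [leRHS]mulrCA.
  have [->|x_neq0] := eqVneq x 0; first by rewrite !mul0r.
  have x_gt0 : 0 < x by rewrite lt0r x_neq0.
  rewrite ler_pM2l//; apply: relative_entropy_mixture => //.
    exact: le_trans (mulr_ge0 _ _) xuv.
  move=> v0; apply/eqP; rewrite eq_le u0 andbT.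
  by rewrite -(pmulr_rle0 _ x_gt0) -v0.
have q1 : 1 - q = p * (1 - a) + (1 - p) * (1 - d) by rewrite /q; ring.
have [pa pa'] : 0 <= p * a /\ 0 <= p * (1 - a) by split; nra.
have [pd pd'] : 0 <= (1 - p) * d /\ 0 <= (1 - p) * (1 - d) by split; nra.
rewrite [leRHS]mulrDr; apply: lerD; rewrite [leRHS]mulrDr; apply: lerD;
  apply: weighted => //; lra.
Qed.

End BinaryChannels.

(** * Existence of an optimal projective pair *)

Section OptimalProjectors.
Variable R : realType.

Definition projector_pair (P : 'M[R[i]]_2) (y : bool) : 'M[R[i]]_2 :=
  if y then 1%:M - P else P.

Lemma orthogonal_projector_pairP P :
  orthogonal_projection P -> orthogonal_projector_pair (projector_pair P).
Proof.
move=> hP; have hy y : orthogonal_projection (projector_pair P y).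
  by case: y => //=; exact: complement_projection.
split=> //; split=> [y|]; first exact: psdmx_projection.
by rewrite /= addrC subrK.
Qed.

Lemma orthogonal_projection1 n : orthogonal_projection (1%:M : 'M[R[i]]_n).
Proof. by split; rewrite ?mulmx1// hermsymmxE trmx1 map_mx1. Qed.

Lemma orthogonal_projection0 n : orthogonal_projection (0 : 'M[R[i]]_n).
Proof. by split; rewrite ?mulmx0// hermsymmxE trmx0 map_mx0. Qed.

Definition outcome_prob n (A S : 'M[R[i]]_n) : R := complex.Re (\tr (A *m S)).

Lemma outcome_prob_complement n (A B S : 'M[R[i]]_n) :
  A + B = 1%:M -> \tr S = 1 -> outcome_prob B S = 1 - outcome_prob A S.
Proof.
move=> /(canRL (addKr _)) -> trS; rewrite /outcome_prob mulmxDl mul1mx mulNmx.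
by rewrite addrC !raddfD !raddfN /= trS.
Qed.

Lemma outcome_prob_projection n (P S : 'M[R[i]]_n) :
  orthogonal_projection P -> psdmx S -> \tr S = 1 -> 0 <= outcome_prob P S <= 1.
Proof.
have ge0 Q : orthogonal_projection Q -> psdmx S -> 0 <= outcome_prob Q S.
  by move=> hQ /(mxtrace_projection_ge0 hQ); rewrite lecE => /andP[].
move=> hP hS trS; rewrite ge0//= -subr_ge0.
rewrite -(outcome_prob_complement (B := 1%:M - P) _ trS) ?(addrC P) ?subrK//.
by rewrite ge0//; exact: complement_projection.
Qed.

Lemma outcome_prob_mixture n (P S : 'M[R[i]]_n) (l m : R) : \tr S = 1 ->
  outcome_prob (l%:C *: P + m%:C *: 1%:M) S = l * outcome_prob P S + m.
Proof.
move=> trS; rewrite /outcome_prob mulmxDl -!scalemxAl mul1mx linearD.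
rewrite !linearZ /= trS.
by case: (\tr (P *m S)) => x y /=; ring.
Qed.

Lemma max_of_three (x y z : R) :
  [\/ y <= x /\ z <= x, x <= y /\ z <= y | x <= z /\ y <= z].
Proof.
have [xy|/ltW yx] := leP x y; have [yz|/ltW zy] := leP y z.
- by apply: Or33; split=> //; exact: le_trans yz.
- by apply: Or32.
- have [xz|/ltW zx] := leP x z; first by apply: Or33.
  by apply: Or31.
- by apply: Or31; split=> //; exact: le_trans yx.
Qed.

(** Common core for both functionals: [K] holds the admissible values of p_0, a single point for the
    success probability and [[0, 1]] for the capacity. The mixture inequality on [g] reduces any
    POVM to three kinds of projective pairs, and compactness gives a best one of each kind. *)
Lemma optimal_projection (K : set R) (g : R -> R -> R -> R)
    (S : bool -> 'M[R[i]]_2) :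
  K !=set0 -> compact K ->
  continuous (fun z : R * (R * R) => g z.1 z.2.1 z.2.2) ->
  (forall p a d l m0 m1, K p -> 0 <= a <= 1 -> 0 <= d <= 1 ->
     0 <= l -> 0 <= m0 -> 0 <= m1 -> l + m0 + m1 = 1 ->
     g p (l * a + m0) (l * d + m0) <=
       l * g p a d + m0 * g p 1 1 + m1 * g p 0 0) ->
  (forall x, psdmx (S x)) -> (forall x, \tr (S x) = 1) ->
  exists P p, [/\ orthogonal_projection P, K p &
    forall p' Pi, K p' -> binary_povm Pi ->
      g p' (outcome_prob (Pi false) (S false))
           (outcome_prob (Pi false) (S true))
      <= g p (outcome_prob P (S false)) (outcome_prob P (S true))].
Proof.
move=> [k Kk] cK cg gmix psdS trS.
pose G (z : R * (R * R)) := g z.1 z.2.1 z.2.2.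
pose F A p := g p (outcome_prob A (S false)) (outcome_prob A (S true)).
have F1 p : F 1%:M p = g p 1 1 by rewrite /F /outcome_prob !mul1mx !trS.
have F0 p : F 0 p = g p 0 0 by rewrite /F /outcome_prob !mul0mx mxtrace0.
have cst_max A : exists2 p, K p & forall p', K p' -> F A p' <= F A p.
  have cF : continuous (F A).
    move=> p; apply: (@continuous_comp _ _ _
      (fun p => (p, (outcome_prob A (S false), outcome_prob A (S true)))) G);
      last exact: cg.
    by apply: continuous_pair => ?; [exact: cvg_id|exact: cvg_cst].
  have [p] := compact_EVT_max (ex_intro _ k Kk) cK (continuous_subspaceT cF).
  rewrite inE => Kp pmax; exists p => // p' Kp'; apply: pmax; rewrite inE//.
have [p1 Kp1 max1] := cst_max 1%:M.
have [p0 Kp0 max0] := cst_max 0.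
(* Decomposing the trivial pair [{0, I}] supplies a unit vector, so the sphere is nonempty. *)
have [v0 [_ [_ [_ [v01 _ _ _]]]]] :=
  povm_mixture (orthogonal_projector_pairP (@orthogonal_projection0 2)).1.
have [c0 c0v] := cvec_surj v0.
pose Fv (z : R * 'rV[R]_(2 + 2)) := F (ket_bra (cvec z.2)) z.1.
have cFv : continuous Fv.
  have cout x : continuous (fun z : R * 'rV[R]_(2 + 2) =>
      outcome_prob (ket_bra (cvec z.2)) (S x)).
    move=> z; apply: (@continuous_comp _ _ _ snd
      (fun c => outcome_prob (ket_bra (cvec c)) (S x))); first exact: cvg_snd.
    exact: continuous_ket_bra_trace.
  move=> z; apply: (@continuous_comp _ _ _
    (fun z : R * 'rV[R]_(2 + 2) =>
       (z.1, (outcome_prob (ket_bra (cvec z.2)) (S false),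
              outcome_prob (ket_bra (cvec z.2)) (S true)))) G); last exact: cg.
  apply: continuous_pair => [?|]; first exact: cvg_fst.
  by apply: continuous_pair; exact: cout.
have KS0 : (K `*` @unit_sphere R 2) !=set0.
  by exists (k, c0); split=> //=; rewrite /unit_sphere /= c0v.
have [[p2 c2] + max2] := compact_EVT_max KS0
  (compact_setX cK (@compact_unit_sphere R 2)) (continuous_subspaceT cFv).
rewrite inE => -[/= Kp2 c2S].
have {}max2 p c : K p -> unit_sphere c ->
    F (ket_bra (cvec c)) p <= F (ket_bra (cvec c2)) p2.
  by move=> Kp cS; apply: (max2 (p, c)); rewrite inE.
set M1 := F 1%:M p1 in max1; set M0 := F 0 p0 in max0.
set M2 := F (ket_bra (cvec c2)) p2 in max2.
(* The best of the three maxima, for [I], for [0] and over rank-one projectors, dominates the other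
   two. *)
have [P [p [projP Kp ge1 ge0 ge2]]] : exists P p,
    [/\ orthogonal_projection P, K p, M1 <= F P p, M0 <= F P p & M2 <= F P p].
  case: (max_of_three M1 M0 M2) => -[h h'].
  - by exists 1%:M, p1; split; [exact: orthogonal_projection1|..].
  - by exists 0, p0; split; [exact: orthogonal_projection0|..].
  - by exists (ket_bra (cvec c2)), p2; split; [exact: ket_bra_projection|..].
exists P, p; split=> // p' Pi Kp' povmPi.
have [v [l [m0 [m1 [vv [l_ge0 m0_ge0 m1_ge0] sum1 ->]]]]] :=
  povm_mixture povmPi.
have [c cv] := cvec_surj v.
have out01 x : 0 <= outcome_prob (ket_bra v) (S x) <= 1.
  by apply: outcome_prob_projection => //; exact: ket_bra_projection.
rewrite !outcome_prob_mixture//.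
apply: (le_trans (gmix _ _ _ _ _ _ Kp' (out01 _) (out01 _)
  l_ge0 m0_ge0 m1_ge0 sum1)).
rewrite -F1 -F0 -/(F (ket_bra v) p') -/(F P p).
have hv : F (ket_bra v) p' <= F P p.
  apply: le_trans ge2; rewrite -cv; apply: max2 => //.
  by rewrite /unit_sphere /= cv.
have h1 : F 1%:M p' <= F P p by apply: le_trans ge1; exact: max1.
have h0 : F 0 p' <= F P p by apply: le_trans ge0; exact: max0.
(* The weights sum to 1, so a bound on each component bounds the mixture. *)
rewrite -[leRHS]mul1r -sum1 !mulrDl.
by apply: lerD; [apply: lerD|]; exact: ler_wpM2l.
Qed.

End OptimalProjectors.

(** * Both functionals in terms of the probabilities of outcome 0 *)

Section Transitions.
Variable R : realType.
Variables (E : 'M[R[i]]_2 -> 'M[R[i]]_2) (rho : bool -> 'M[R[i]]_2).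
Hypothesis trE : forall x, \tr (E (rho x)) = 1.
Variable Pi : bool -> 'M[R[i]]_2.
Hypothesis povmPi : binary_povm Pi.
Variable p : bool -> R.
Hypothesis distp : bit_distribution p.

Let out x := outcome_prob (Pi false) (E (rho x)).

Let transition_false x : transition E rho Pi false x = out x.
Proof. by []. Qed.

Let transition_true x : transition E rho Pi true x = 1 - out x.
Proof. by case: povmPi => _ sumPi; exact: outcome_prob_complement. Qed.

Let p_true : p true = 1 - p false.
Proof. by case: distp => _ <-; rewrite addrAC subrr add0r. Qed.

Lemma prob_correctE : prob_correct E rho p Pi =
  success_probability (p false) (out false) (out true).
Proof. by rewrite /prob_correct transition_false transition_true p_true. Qed.

Lemma prob_errorE : prob_error E rho p Pi = 1 - prob_correct E rho p Pi.
Proof.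
rewrite prob_correctE /success_probability /prob_error.
rewrite transition_false transition_true p_true.
by move: (out false) (out true) (p false) => a d k; ring.
Qed.

Lemma mutual_informationE b : mutual_information E rho b p Pi =
  binary_information (p false) (out false) (out true) / ln b.
Proof.
rewrite /mutual_information.
move: (transition E rho Pi) transition_false transition_true => t tF tT.
rewrite !big_bool /= !tF !tT p_true /logb.
rewrite /binary_information /relative_entropy_term.
move: (out false) (out true) (p false) => a d k.
have -> : (1 - d) * (1 - k) + (1 - a) * k = 1 - (k * a + (1 - k) * d) by ring.
have -> : d * (1 - k) + a * k = k * a + (1 - k) * d by ring.
(* With the logarithms abstracted, the identity is purely algebraic. *)
move: (ln (1 - (k * a + _))) (ln (k * a + _)) => l1q lq.
move: (ln a) (ln d) (ln (1 - a)) (ln (1 - d)) (ln b) => la ld l1a l1d lb.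
by ring.
Qed.

End Transitions.

(** * Optimality for the success probability and the capacity *)

Lemma sup_maximum (R : realType) (A : set R) x : A x -> ubound A x -> sup A = x.
Proof.
move=> Ax ubx; apply/eqP; rewrite eq_le ge_sup//; last by exists x.
by rewrite ub_le_sup//; exists x.
Qed.

Theorem corollary1 (R : realType)
    (E : {linear 'M[R[i]]_2 -> 'M[R[i]]_2}) (rho : bool -> 'M[R[i]]_2)
    (hE : qubit_channel E) (hrho : forall x, qubit_state (rho x)) :
  (forall p : bool -> R, bit_distribution p ->
     exists Pi : bool -> 'M[R[i]]_2,
       [/\ orthogonal_projector_pair Pi,
           maximizes_over_povms (prob_correct E rho p) Pi
         & minimizes_over_povms (prob_error E rho p) Pi])
  /\
  (forall b : R, 1 < b ->
     exists Pi : bool -> 'M[R[i]]_2,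
       orthogonal_projector_pair Pi /\
       maximizes_over_povms (binary_capacity E rho b) Pi).
Proof.
case: hE => cpE tpE.
have psdE x : psdmx (E (rho x)).
  by apply: completely_positive_psdmx => //; case: (hrho x).
have trE x : \tr (E (rho x)) = 1 by rewrite tpE; case: (hrho x).
split=> [p distp|b b1].
  have mix (k a d l m0 m1 : R) : [set p false] k -> 0 <= a <= 1 ->
      0 <= d <= 1 -> 0 <= l -> 0 <= m0 -> 0 <= m1 -> l + m0 + m1 = 1 ->
      success_probability k (l * a + m0) (l * d + m0) <=
      l * success_probability k a d + m0 * success_probability k 1 1 +
        m1 * success_probability k 0 0.
    by move=> _ _ _ _ _ _ /success_probability_mixture ->.
  (* The input distribution is fixed, hence the singleton set of values of p_0. *)
  have [P [_ [projP -> Pmax]]] := optimal_projection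
    (ex_intro _ _ erefl) (@compact_set1 _ (p false))
    (@continuous_success_probability R) mix psdE trE.
  have [povmP _] := orthogonal_projector_pairP projP.
  have max_correct Pi : binary_povm Pi ->
      prob_correct E rho p Pi <= prob_correct E rho p (projector_pair P).
    move=> povmPi; rewrite (prob_correctE trE povmPi distp).
    by rewrite (prob_correctE trE povmP distp); exact: Pmax.
  exists (projector_pair P); split; first exact: orthogonal_projector_pairP.
    by split.
  split=> [|Pi povmPi]; first exact: povmP.
  rewrite (prob_errorE trE povmPi distp) (prob_errorE trE povmP distp).
  by rewrite lerD2l lerN2 max_correct.
have lnb : 0 < ln b by rewrite ln_gt0.
have mix (k a d l m0 m1 : R) : `[0, 1]%classic k -> 0 <= a <= 1 ->
    0 <= d <= 1 -> 0 <= l -> 0 <= m0 -> 0 <= m1 -> l + m0 + m1 = 1 ->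
    binary_information k (l * a + m0) (l * d + m0) <=
    l * binary_information k a d + m0 * binary_information k 1 1 +
      m1 * binary_information k 0 0.
  by rewrite /= in_itv /=; exact: binary_information_mixture.
have itv0 : `[(0 : R), 1]%classic !=set0.
  by exists 0; rewrite /= in_itv /= lexx ler01.
have [P [k [projP k01 Pmax]]] := optimal_projection
  itv0 (@segment_compact R 0 1) (@continuous_binary_information R) mix psdE trE.
have [povmP _] := orthogonal_projector_pairP projP.
have k_itv : 0 <= k <= 1 by move: k01; rewrite /= in_itv.
have dist_itv q : bit_distribution q -> `[(0 : R), 1]%classic (q false).
  by move=> [q_ge0 q_sum]; rewrite /= in_itv /= q_ge0 -q_sum lerDl q_ge0.
(* The input distribution with p_0 equal to the jointly optimal [k]. *)
pose pk (x : bool) := if x then 1 - k else k.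
have distpk : bit_distribution pk.
  case/andP: k_itv => k_ge0 k_le1.
  by split=> [[]|] /=; rewrite ?subr_ge0// addrC subrK.
pose cap := mutual_information E rho b pk (projector_pair P).
have le_cap Pi q : binary_povm Pi -> bit_distribution q ->
    mutual_information E rho b q Pi <= cap.
  move=> povmPi distq; rewrite /cap (mutual_informationE trE povmPi distq).
  rewrite (mutual_informationE trE povmP distpk) ler_pM2r ?invr_gt0//.
  exact: Pmax (dist_itv _ distq) povmPi.
exists (projector_pair P); split; first exact: orthogonal_projector_pairP.
split=> [|Pi povmPi]; first exact: povmP.
(* The joint maximum [cap] is attained at [pk], so it is the capacity of the projective pair, while
   [le_cap] bounds the capacity of every POVM by it. *)
rewrite [leRHS](_ : _ = cap).
  apply: ge_sup; first by exists (mutual_information E rho b pk Pi), pk.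
  by move=> _ [q distq <-]; exact: le_cap.
apply: sup_maximum; first by exists pk.
by move=> _ [q distq <-]; exact: le_cap.
Qed.
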